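(* Let $X$ be a compact torsion group, and let $G\cong \mathbb{R}^{n}\bigoplus A\bigoplus M\bigoplus \prod_{p\in I}F_p^{n_p}$, where $n$ is a non-negative integer, $A$ is a discrete, torsion-free, divisible group, $M$ is a compact, connected, torsion-free group, $I$ is a finite subset of the set $P$ of all prime numbers, and $n_p=1$ if $p\in I$ and $n_p=0$ if $p\notin I$. Then $\mathrm{Ext}(X,G)=0$.
   Context: All groups are Hausdorff abelian topological groups, written additively; $\cong$ denotes topological isomorphism. Let $\mathcal{L}$ be the category of locally compact abelian (LCA) groups with continuous homomorphisms as morphisms. A morphism is proper if it is open onto its image. A short exact sequence $0\to A'\stackrel{\phi}{\to}B'\stackrel{\psi}{\to}C'\to 0$ in $\mathcal{L}$ is proper exact if $\phi$ and $\psi$ are proper; it is then called an extension of $A'$ by $C'$. For $A',C'\in\mathcal{L}$, $\mathrm{Ext}(C',A')$ denotes the (discrete) abelian group of (equivalence classes of) extensions of $A'$ by $C'$ in $\mathcal{L}$, with Baer sum; $\mathrm{Ext}(C',A')=0$ means that every such extension splits. A group is torsion if each of its elements has finite order. $F_p$ is the additive topological group of $p$-adic numbers with its usual topology, i.e. the minimal divisible extension of the group $J_p$ of $p$-adic integers. $\mathbb{R}$ is the additive group of real numbers with its usual topology. *)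

(* Defs.v *)
From HB Require Import structures.
From mathcomp Require Import all_boot all_order all_algebra.
From mathcomp Require Import finmap ring.
From mathcomp Require Import all_classical all_reals all_analysis.
Import numFieldNormedType.Exports.
Import Order.TTheory GRing.Theory Num.Theory.

Set Implicit Arguments.
Unset Strict Implicit.
Unset Printing Implicit Defensive.

Local Open Scope classical_set_scope.
Local Open Scope ring_scope.

(** An alias of the product type: the library only declares the topological
    group structure of G * H for G and H topological vector spaces. *)
Definition dsum (G H : Type) : Type := (G * H)%type.

Section DirectSum.
Variables G H : topologicalZmodType.

HB.instance Definition _ := Topological.copy (dsum G H) (G * H)%type.
HB.instance Definition _ := GRing.Zmodule.copy (dsum G H) (G * H)%type.

Let dsum_sub_continuous :
  continuous (fun x : dsum G H * dsum G H => x.1 - x.2).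
Proof.
have c1 : continuous (fun y : (G * H) * (G * H) => y.1.1 - y.2.1).
  move=> x; apply: (@continuous_comp _ _ _
    (fun y : (G * H) * (G * H) => (y.1.1, y.2.1)) (fun z : G * G => z.1 - z.2));
    last exact: sub_continuous.
  apply: cvg_pair.
    by apply: (@continuous_comp _ _ _ fst fst); exact: cvg_fst.
  by apply: (@continuous_comp _ _ _ snd fst); [exact: cvg_snd|exact: cvg_fst].
have c2 : continuous (fun y : (G * H) * (G * H) => y.1.2 - y.2.2).
  move=> x; apply: (@continuous_comp _ _ _
    (fun y : (G * H) * (G * H) => (y.1.2, y.2.2)) (fun z : H * H => z.1 - z.2));
    last exact: sub_continuous.
  apply: cvg_pair.
    by apply: (@continuous_comp _ _ _ fst snd); [exact: cvg_fst|exact: cvg_snd].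
  by apply: (@continuous_comp _ _ _ snd snd); exact: cvg_snd.
by move=> x; exact: cvg_pair (c1 x) (c2 x).
Qed.

HB.instance Definition _ :=
  PreTopologicalNmodule_isTopologicalZmodule.Build (dsum G H)
    dsum_sub_continuous.

End DirectSum.

Lemma continuous_prod_topology (T : topologicalType) (I : Type)
    (K : I -> topologicalType) (f : T -> prod_topology K) :
  (forall i, continuous (fun x => f x i)) -> continuous f.
Proof.
move=> fc x; apply/cvg_sup => i U [V [[W oW <-] Wfx WU]].
have : nbhs x ((fun y => f y i) @^-1` W).
  by apply: fc; exact: open_nbhs_nbhs.
by apply: filterS => y Wy; exact: WU.
Qed.

Lemma eval_continuous (I : Type) (K : I -> topologicalType) (i : I) :
  continuous (fun f : prod_topology K => f i).
Proof.
move=> f; have /cvg_sup/(_ i) h : f --> f by exact: cvg_id.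
by apply: (cvg_trans _ (@initial_continuous _ _ (fun g : forall j, K j => g i) f));
  exact: cvg_app.
Qed.

Section DependentProduct.
Variables (I : Type) (K : I -> topologicalZmodType).
Local Notation P := (prod_topology K).

Let add (f g : P) : P := fun i => f i + g i.
Let opp (f : P) : P := fun i => - f i.
Let zero : P := fun i => 0.

Let addA : associative add.
Proof. by move=> f g h; apply: functional_extensionality_dep => i; exact: addrA. Qed.

Let addC : commutative add.
Proof. by move=> f g; apply: functional_extensionality_dep => i; exact: addrC. Qed.

Let add0 : left_id zero add.
Proof. by move=> f; apply: functional_extensionality_dep => i; exact: add0r. Qed.

Let addN : left_inverse zero opp add.
Proof. by move=> f; apply: functional_extensionality_dep => i; exact: addNr. Qed.

HB.instance Definition _ := GRing.isZmodule.Build P addA addC add0 addN.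

Let dprod_sub_continuous : continuous (fun x : P * P => x.1 - x.2).
Proof.
apply: continuous_prod_topology => i x.
apply: (@continuous_comp _ _ _ (fun y : P * P => (y.1 i, y.2 i))
  (fun z : K i * K i => z.1 - z.2)); last exact: sub_continuous.
apply: cvg_pair.
  apply: (@continuous_comp _ _ _ fst (fun f : P => f i)); first exact: cvg_fst.
  exact: eval_continuous.
apply: (@continuous_comp _ _ _ snd (fun f : P => f i)); first exact: cvg_snd.
exact: eval_continuous.
Qed.

HB.instance Definition _ :=
  PreTopologicalNmodule_isTopologicalZmodule.Build P dprod_sub_continuous.

End DependentProduct.

(** Elements of the localization of Z at p: denominator prime to p. *)
Definition Zlocal (p : nat) : set rat := [set q | coprime p `|denq q|%N].

(** For p prime these are the closed balls p^n Z_(p) around 0 for the p-adic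
    absolute value on Q. *)
Definition pball (p n : nat) : set rat :=
  [set p%:R ^+ n * r | r in Zlocal p].

(** The p-adic completion of Q, that is the inverse limit of the discrete groups
    Q / p^n Z_(p): a p-adic number x is a decreasing sequence whose n-th term
    is a coset of p^n Z_(p), namely the set of the rationals q such that
    |x - q|_p <= p^-n. The compact open subgroup J_p of the p-adic integers is
    {x | x 0 = Z_(p)}, and the group is the union of the p^-k J_p. *)
Record padic (p : nat) := Padic {
  padic_res :> nat -> set rat;
  padic_resP : forall n, exists q, padic_res n = [set q + r | r in pball p n];
  padic_resS : forall n, padic_res n.+1 `<=` padic_res n }.

Lemma padic_inj (p : nat) (x y : padic p) : (forall n, x n = y n) -> x = y.
Proof.
move=> xy; have {xy} : padic_res x = padic_res y by apply/funext.
case: x y => [x xP xS] [y yP yS] /= xy; rewrite -{}xy in yP yS *.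
by congr Padic; exact: Prop_irrelevance.
Qed.

HB.instance Definition _ (p : nat) := gen_eqMixin (padic p).
HB.instance Definition _ (p : nat) := gen_choiceMixin (padic p).

Section PadicGroup.
Variable p : nat.
Implicit Types (q r : rat) (x y z : padic p).

Lemma Zlocal_frac (m : int) (d : nat) q :
  d != 0%N -> coprime p d -> q * d%:R = m%:~R -> Zlocal p q.
Proof.
move=> d0 pd qd; rewrite /Zlocal /=; apply: coprime_dvdr pd.
have e : (numq q * d%:Z = m * denq q)%R.
  apply: (@intr_inj rat); rewrite !intrM numqE -qd -pmulrn; ring.
have : (`|denq q| %| `|numq q| * d)%N.
  by rewrite -[X in (_ * X)%N]/(`|d%:Z|%N) -abszM e abszM dvdn_mull.
by rewrite Gauss_dvdr // coprime_sym coprime_num_den.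
Qed.

Lemma ZlocalB q r : Zlocal p q -> Zlocal p r -> Zlocal p (q - r).
Proof.
rewrite /Zlocal /= => pq pr.
apply: (@Zlocal_frac (numq q * denq r - numq r * denq q)
  (`|denq q| * `|denq r|)%N).
- by rewrite muln_eq0 !absz_eq0 !denq_eq0.
- by rewrite coprimeMr pq.
- rewrite natrM !natr_absz !normr_denq intrD mulrNz !intrM !numqE; ring.
Qed.

Lemma pball0 n : pball p n 0.
Proof. by exists 0; [exact: coprimen1|exact: mulr0]. Qed.

Lemma pballB n q r : pball p n q -> pball p n r -> pball p n (q - r).
Proof.
move=> [a aZ <-] [b bZ <-]; exists (a - b); first exact: ZlocalB.
by rewrite mulrBr.
Qed.

Lemma pballN n q : pball p n q -> pball p n (- q).
Proof. by move=> qB; rewrite -sub0r; apply: pballB => //; exact: pball0. Qed.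

Lemma pballD n q r : pball p n q -> pball p n r -> pball p n (q + r).
Proof. by move=> qB rB; rewrite -[r]opprK; apply: pballB => //; exact: pballN. Qed.

Lemma pballS n : pball p n.+1 `<=` pball p n.
Proof.
move=> _ [r rZ <-]; exists (p%:R * r); last by rewrite mulrA -exprSr.
apply: (@Zlocal_frac (p%:Z * numq r) `|denq r|%N) => //.
- by rewrite absz_eq0 denq_eq0.
- by rewrite intrM numqE natr_absz normr_denq -pmulrn mulrA.
Qed.

Lemma padicP x n q : x n q -> forall r, x n r <-> pball p n (r - q).
Proof.
have [c ->] := padic_resP x n.
move=> [a aB <-] r; split=> [[b bB <-]|rB].
  rewrite (_ : _ - _ = b - a); last by ring.
  exact: pballB.
exists (r - (c + a) + a); first exact: pballD.
by ring.
Qed.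

Lemma padic_ex x n : exists q, x n q.
Proof.
have [c ->] := padic_resP x n.
by exists c, 0; [exact: pball0|rewrite addr0].
Qed.

Let zero_res n := pball p n.

Let zero_resP n : exists q, zero_res n = [set q + r | r in pball p n].
Proof.
exists 0; rewrite seteqP; split=> [r rB|_ [r rB <-]]; last by rewrite add0r.
by exists r; rewrite ?add0r.
Qed.

Definition padic_zero : padic p := Padic zero_resP pballS.

Let add_res x y n : set rat := [set a + b | a in x n & b in y n].

Let add_resP x y n : exists q, add_res x y n = [set q + r | r in pball p n].
Proof.
have [a xa] := padic_ex x n; have [b yb] := padic_ex y n.
exists (a + b); rewrite seteqP; split=> [_ [c xc] [d yd] <-|_ [r rB <-]].
  exists ((c - a) + (d - b)); last by ring.
  by apply: pballD; [exact/(padicP xa)|exact/(padicP yb)].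
exists (a + r); last by exists b => //; ring.
by apply/(padicP xa); rewrite (_ : _ - _ = r) //; ring.
Qed.

Let add_resS x y n : add_res x y n.+1 `<=` add_res x y n.
Proof.
by move=> _ [a xa] [b yb] <-; exists a; [exact: padic_resS|exists b => //; exact: padic_resS].
Qed.

Definition padic_add x y : padic p := Padic (@add_resP x y) (@add_resS x y).

Let opp_res x n : set rat := [set - a | a in x n].

Let opp_resP x n : exists q, opp_res x n = [set q + r | r in pball p n].
Proof.
have [a xa] := padic_ex x n; exists (- a).
rewrite seteqP; split=> [_ [c xc <-]|_ [r rB <-]].
  exists (- (c - a)); last by ring.
  by apply: pballN; exact/(padicP xa).
exists (a - r); last by ring.
by apply/(padicP xa); rewrite (_ : _ - _ = - r); [exact: pballN|ring].
Qed.

Let opp_resS x n : opp_res x n.+1 `<=` opp_res x n.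
Proof. by move=> _ [a xa <-]; exists a => //; exact: padic_resS. Qed.

Definition padic_opp x : padic p := Padic (@opp_resP x) (@opp_resS x).

Let addA : associative padic_add.
Proof.
move=> x y z; apply: padic_inj => n; rewrite seteqP; split=> q /=.
  move=> [a xa] [_ [b yb] [c zc <-]] <-.
  by exists (a + b); [exists a => //; exists b|exists c => //; rewrite addrA].
move=> [_ [a xa] [b yb <-]] [c zc] <-.
by exists a => //; exists (b + c); [exists b => //; exists c|rewrite addrA].
Qed.

Let addC : commutative padic_add.
Proof.
move=> x y; apply: padic_inj => n; rewrite seteqP.
by split=> q /= [a xa] [b yb] <-; exists b => //; exists a => //; rewrite addrC.
Qed.

Let add0 : left_id padic_zero padic_add.
Proof.
move=> x; apply: padic_inj => n; rewrite seteqP; split=> q /=.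
  by move=> [a aB] [b xb] <-; apply/(padicP xb); rewrite addrK.
by move=> xq; exists 0; [exact: pball0|exists q => //; rewrite add0r].
Qed.

Let addN : left_inverse padic_zero padic_opp padic_add.
Proof.
move=> x; apply: padic_inj => n; rewrite seteqP; split=> q /=.
  by move=> [_ [a xa <-]] [b xb] <-; rewrite addrC; apply/(padicP xa).
move=> qB; have [a xa] := padic_ex x n.
exists (- a); first by exists a.
by exists (a + q); [apply/(padicP xa); rewrite addrC addKr|rewrite addKr].
Qed.

HB.instance Definition _ := GRing.isZmodule.Build (padic p) addA addC add0 addN.

Definition padic_seq x :
  prod_topology (fun _ : nat => discrete_topology (set rat)) := padic_res x.

HB.instance Definition _ :=
  Topological.copy (padic p) (initial_topology padic_seq).

Let padic_sub_continuous : continuous (fun x : padic p * padic p => x.1 - x.2).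
Proof.
have res_near (x : padic p) n : \forall y \near x, (y : padic p) n = x n.
  have c : {for x, continuous (fun y : padic p => padic_seq y n)}.
    apply: (@continuous_comp _ _ _ padic_seq (fun f => f n)).
      exact: initial_continuous.
    exact: eval_continuous.
  exact: (c [set s | s = x n]).
move=> x U [_ [[V oV <-] Vx VU]].
apply: (filterS VU) => {U VU}.
have : continuous (fun y : padic p * padic p => padic_seq (y.1 - y.2)).
  apply: continuous_prod_topology => n y W /= Wy.
  exists ([set a | (a : padic p) n = y.1 n], [set b | (b : padic p) n = y.2 n]).
    by split; exact: res_near.
  move=> [a b] /= [an bn].
  change (W (padic_seq (a - b) n)).
  have <- : padic_seq (y.1 - y.2) n = padic_seq (a - b) n.
    by rewrite /padic_seq /= /add_res /= /opp_res an bn.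
  exact: nbhs_singleton.
by move/continuousP => /(_ _ oV) oW; exact: open_nbhs_nbhs.
Qed.

HB.instance Definition _ :=
  PreTopologicalNmodule_isTopologicalZmodule.Build (padic p)
    padic_sub_continuous.

End PadicGroup.

Record lcaGroup := LcaGroup {
  lca_sort :> topologicalZmodType;
  lca_hausdorff : hausdorff_space lca_sort;
  lca_locally_compact : locally_compact [set: lca_sort] }.

Definition topological_isomorphism (G H : topologicalZmodType)
    (f : {additive G -> H}) : Prop :=
  exists g : {additive H -> G},
    [/\ cancel f g, cancel g f, continuous f & continuous g].

Definition topologically_isomorphic (G H : topologicalZmodType) : Prop :=
  exists f : {additive G -> H}, topological_isomorphism f.

Definition proper_morphism (G H : topologicalZmodType) (f : {additive G -> H})
    : Prop :=
  continuous f /\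
  forall U, open U -> exists2 V, open V & f @` U = V `&` range f.

(** Proper exact sequences 0 -> A -> ext_mid -> C -> 0. *)
Record extension (C A : lcaGroup) := Extension {
  ext_mid : lcaGroup;
  ext_inj : {additive A -> ext_mid};
  ext_proj : {additive ext_mid -> C};
  ext_inj_proper : proper_morphism ext_inj;
  ext_proj_proper : proper_morphism ext_proj;
  ext_injective : injective ext_inj;
  ext_exact : range ext_inj = [set b | ext_proj b = 0];
  ext_surjective : range ext_proj = [set: C] }.

(** Equivalence with the direct sum extension, whose class is the zero of
    Ext(C, A). *)
Definition splits (C A : lcaGroup) (E : extension C A) : Prop :=
  exists f : {additive ext_mid E -> dsum A C},
    [/\ topological_isomorphism f,
        forall a : A, f (ext_inj E a) = (a, 0)
      & forall b : ext_mid E, (f b).2 = ext_proj E b].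

Definition Ext_zero (C A : lcaGroup) : Prop :=
  forall E : extension C A, splits E.

Definition torsion (G : zmodType) : Prop :=
  forall x : G, exists2 n : nat, (0 < n)%N & x *+ n = 0.

Definition torsion_free (G : zmodType) : Prop :=
  forall (x : G) (n : nat), (0 < n)%N -> x *+ n = 0 -> x = 0.

Definition divisible (G : zmodType) : Prop :=
  forall (x : G) (n : nat), (0 < n)%N -> exists y : G, y *+ n = x.

Definition discrete (T : topologicalType) : Prop :=
  forall A : set T, open A.

(* Main.v *)
Require Import Defs.
From HB Require Import structures.
From mathcomp Require Import all_boot all_order all_algebra all_field.
From mathcomp Require Import finmap ring.
From mathcomp Require Import all_classical all_reals all_analysis.
Import numFieldNormedType.Exports.
Import Order.TTheory GRing.Theory Num.Theory.

(** Multiplication by every m > 0 is a homeomorphism of G onto itself, and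
    this alone makes Ext(X, G) vanish for every X of bounded exponent m: in an
    extension B of G by X the multiple m b of any b lies in G, so that
    r b = m^-1 (m b) is a continuous retraction of B onto G, and r splits the
    extension ([Ext_zero_continuously_divisible]). Two facts remain.

    A compact torsion group X has bounded exponent
    ([compact_torsion_bounded]): by Baire's argument one of the closed subgroups
    {x | n! x = 0} is a neighbourhood of 0, hence has finite index.

    Multiplication by m is a homeomorphism of each summand of G. Its inverse is
    scaling on R^n, is continuous for free on the discrete summand, and shifts
    residues on the p-adic numbers ([continuously_divisible_padic]). On M it is
    enough, by compactness, that M be divisible. That compact connected groups
    are divisible is usually read off Pontryagin duality, their dual being
    torsion free; the proof below only uses the characters of the finite groups
    P = (Z/m)^n, through a lemma of Bogolyubov.

    To prove that m M is dense in M ([dense_multiples]), fix a neighbourhood U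
    of 0, with k translates of U covering M, and map P to M by sending a vector
    v to the combination of the points g_i of a fine net with coefficients v_i,
    a map phi which is additive modulo m M. By pigeonhole a set A of at least
    |P| / k vectors is mapped into one translate of U. By Bogolyubov's lemma
    A - A + A - A contains a subgroup of P whose index is bounded in terms of m
    and k only ([spectrum_perp], [card_spectrum]). As M is connected, P is
    generated by the vectors that phi maps close to 0 modulo m M, so every
    vector is a sum of an element of A - A + A - A and of a bounded number of
    such vectors ([bounded_generation]). That number does not depend on the net,
    so the net can be chosen so fine that the second part of the sum stays small
    too; hence every point of phi(P), and then of M, is close to m M. *)

Set Implicit Arguments.
Unset Strict Implicit.
Unset Printing Implicit Defensive.

Local Open Scope ring_scope.

(** * Bogolyubov's lemma in (Z/m)^n *)

Section Bogolyubov.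
Variables (q n : nat).
Local Notation P := 'rV['I_q.+2]_n.
Implicit Types (a b x y : P) (A : {set P}).

Definition dotv a x : 'I_q.+2 := \sum_i a 0 i * x 0 i.

Lemma dotvDr a x y : dotv a (x + y) = dotv a x + dotv a y.
Proof. by rewrite /dotv -big_split; apply: eq_bigr => i _; rewrite mxE mulrDr. Qed.

Lemma dotvDl a b x : dotv (a + b) x = dotv a x + dotv b x.
Proof. by rewrite /dotv -big_split; apply: eq_bigr => i _; rewrite mxE mulrDl. Qed.

Lemma dotv0r a : dotv a 0 = 0.
Proof. by apply: (addrI (dotv a 0)); rewrite -dotvDr !addr0. Qed.

Lemma dotv0l x : dotv 0 x = 0.
Proof. by apply: (addrI (dotv 0 x)); rewrite -dotvDl !addr0. Qed.

Lemma dotv_delta i x : dotv (delta_mx 0 i) x = x 0 i.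
Proof.
rewrite /dotv (bigD1 i) //= big1 => [|j /negPf ji]; rewrite !mxE ?eqxx ?ji ?mul0r //.
by rewrite addr0 mul1r.
Qed.

Variable z : algC.
Hypothesis zP : q.+2.-primitive_root z.

Definition chi a x : algC := z ^+ dotv a x.

Lemma exprZD (s t : 'I_q.+2) : z ^+ (s + t)%R = z ^+ s * z ^+ t.
Proof. by rewrite -exprD -(prim_expr_mod zP (s + t)%N). Qed.

Lemma chiDr a x y : chi a (x + y) = chi a x * chi a y.
Proof. by rewrite /chi dotvDr exprZD. Qed.

Lemma chiDl a b x : chi (a + b) x = chi a x * chi b x.
Proof. by rewrite /chi dotvDl exprZD. Qed.

Lemma chi0r a : chi a 0 = 1.
Proof. by rewrite /chi dotv0r. Qed.

Lemma normr_chi a x : `|chi a x| = 1.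
Proof.
rewrite /chi normrX; suff -> : `|z| = 1 by rewrite expr1n.
by apply/eqP; rewrite -(@pexpr_eq1 _ _ q.+2) // -normrX (prim_expr_order zP) normr1.
Qed.

Lemma conj_chi a x : (chi a x)^* = chi a (- x).
Proof.
have nz : chi a x != 0 by rewrite -normr_gt0 normr_chi.
apply: (mulfI nz); rewrite -chiDr subrr chi0r.
by rewrite -normCK normr_chi expr1n.
Qed.

(** Orthogonality: if x has a nonzero coordinate i, translating the index by the
    i-th basis vector multiplies the sum by chi e_i x, which is not 1. *)
Lemma sum_chi x : \sum_a chi a x = (#|{: P}| * (x == 0))%:R.
Proof.
have [->|x0] := eqVneq x 0.
  under eq_bigr => a _ do rewrite chi0r.
  by rewrite sumr_const muln1.
rewrite muln0; have [i xi] : exists i, x 0 i != 0.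
  apply/existsP; apply: contraNT x0 => /existsPn x0.
  by apply/eqP/rowP => i; rewrite mxE; apply/eqP; have := x0 i; rewrite negbK.
have : chi (delta_mx 0 i) x != 1.
  rewrite /chi dotv_delta -(expr0 z) (eq_prim_root_expr zP).
  by rewrite modn_small // mod0n.
rewrite -subr_eq0 => /mulfI; apply; rewrite mulr0 mulrBl mul1r.
apply/eqP; rewrite subr_eq0; apply/eqP; rewrite [RHS](reindex_inj (addrI (delta_mx 0 i))) /=.
by rewrite mulr_sumr; apply: eq_bigr => a _; rewrite chiDl.
Qed.

(** The squared modulus of the Fourier coefficient at a of the indicator
    function of A. *)
Definition energy A a : algC := `|\sum_(x in A) chi a x| ^+ 2.

Lemma energyE A a : energy A a = \sum_(b in A) \sum_(c in A) chi a (b - c).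
Proof.
rewrite /energy normCK raddf_sum /= mulr_suml; apply: eq_bigr => b _.
rewrite mulr_sumr; apply: eq_bigr => c _.
by rewrite conj_chi -chiDr.
Qed.

Lemma energy_ge0 A a : 0 <= energy A a.
Proof. by rewrite exprn_ge0. Qed.

Lemma energy0 A : energy A 0 = (#|A| ^ 2)%:R.
Proof.
rewrite /energy natrX; congr (_ ^+ 2).
under eq_bigr => x _ do rewrite /chi dotv0l expr0.
by rewrite sumr_const normr_nat.
Qed.

(** Parseval's identity for the indicator function of A. *)
Lemma sum_energy A : \sum_a energy A a = (#|{: P}| * #|A|)%:R.
Proof.
under eq_bigr => a _ do rewrite energyE.
rewrite exchange_big /=; under eq_bigr => b bA.
  rewrite exchange_big /= (bigD1 b) //= subrr sum_chi eqxx muln1.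
  rewrite big1 ?addr0; last first.
    by move=> c /andP[_ cb]; rewrite sum_chi subr_eq0 eq_sym (negPf cb) muln0.
  over.
by rewrite sumr_const -mulrnA.
Qed.

(** Up to the factor |P|, the sum counts the representations of x as
    b - c + (d - e) with terms in A, by Fourier inversion. *)
Lemma sum_energy2 A x :
  (forall b c d e, b \in A -> c \in A -> d \in A -> e \in A ->
     b - c + (d - e) != x) ->
  \sum_a energy A a ^+ 2 * chi a (- x) = 0.
Proof.
move=> nx.
have E a : energy A a ^+ 2 * chi a (- x) = \sum_(b in A) \sum_(d in A)
    \sum_(c in A) \sum_(e in A) chi a (b - c + (d - e) - x).
  rewrite expr2 energyE mulr_suml mulr_suml; apply: eq_bigr => b _.
  rewrite mulr_sumr mulr_suml; apply: eq_bigr => d _.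
  rewrite mulr_suml mulr_suml; apply: eq_bigr => c _.
  rewrite mulr_sumr mulr_suml; apply: eq_bigr => e _.
  by rewrite -!chiDr.
under eq_bigr => a _ do rewrite E.
rewrite exchange_big big1 //= => b bA; rewrite exchange_big big1 //= => d dA.
rewrite exchange_big big1 //= => c cA; rewrite exchange_big big1 //= => e eA.
by rewrite sum_chi subr_eq0 (negPf (nx _ _ _ _ bA cA dA eA)) muln0.
Qed.

(** The frequencies a whose energy is at least |A|^3 / (2 |P|): with this
    threshold the others contribute at most |A|^4 / 2 to the sum of the squared
    energies, while the frequency 0 alone contributes |A|^4. *)
Definition spectrum A : {set P} :=
  [set a | (#|A| ^ 3)%:R <= 2 * #|{: P}|%:R * energy A a].

(** Parseval's identity leaves room for few frequencies of large energy. The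
    bound does not involve n, which is what makes it useful. *)
Lemma card_spectrum A k :
  (0 < #|A|)%N -> (#|{: P}| <= k * #|A|)%N -> (#|spectrum A| <= 2 * k ^ 2)%N.
Proof.
move=> A0 kA.
have : #|spectrum A|%:R * (#|A| ^ 3)%:R <= 2 * #|{: P}|%:R * \sum_a energy A a.
  rewrite mulr_sumr mulr_natl -sumr_const.
  apply: (@le_trans _ _ (\sum_(a in spectrum A) 2 * #|{: P}|%:R * energy A a)).
    by apply: ler_sum => a; rewrite inE.
  rewrite [leRHS](bigID (mem (spectrum A))) /= lerDl sumr_ge0 // => a _.
  by rewrite mulr_ge0 ?energy_ge0 // mulr_ge0.
rewrite sum_energy -!natrM ler_nat => le1.
have {le1} le2 : (#|spectrum A| * #|A| ^ 2 * #|A| <= 2 * #|{: P}| ^ 2 * #|A|)%N.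
  by apply: leq_trans (leq_trans le1 _); rewrite !expnS ?expn0 ?muln1 !mulnA.
rewrite leq_pmul2r // in le2.
rewrite -(@leq_pmul2r (#|A| ^ 2)) ?expn_gt0 ?A0 //.
by apply: (leq_trans le2); rewrite -mulnA -expnMn leq_pmul2l // leq_exp2r.
Qed.

(** Bogolyubov's lemma. On the annihilator of the spectrum the characters of
    the spectrum are 1, so if x were not represented, the contributions of the
    spectrum, at least |A|^4, would be cancelled by those of the other
    frequencies, at most |A|^4 / 2. *)
Lemma spectrum_perp A x :
  (0 < #|A|)%N -> (forall a, a \in spectrum A -> dotv a x = 0) ->
  exists b c d e, [/\ b \in A, c \in A, d \in A & e \in A] /\ x = b - c + (d - e).
Proof.
move=> A0 xperp.
have [/'exists_'exists_'exists_'exists_and5P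
    [b [c [d [e [bA cA dA eA /eqP xE]]]]]|nex] := boolP
  [exists b, exists c, exists d, exists e,
    [&& b \in A, c \in A, d \in A, e \in A & b - c + (d - e) == x]].
  by exists b, c, d, e.
have nx b c d e : b \in A -> c \in A -> d \in A -> e \in A -> b - c + (d - e) != x.
  move=> bA cA dA eA; apply: contra nex => xE.
  by apply/'exists_'exists_'exists_'exists_and5P; exists b, c, d, e.
have P0 : (0 < #|{: P}|)%N by apply: leq_trans A0 (max_card _).
have s0 : 0 \in spectrum A.
  rewrite inE energy0 -!natrM ler_nat expnS leq_mul2r (leq_trans (max_card _)) ?orbT //.
  by rewrite mul2n -addnn leq_addl.
(* The two halves of the vanishing sum have the same modulus. *)
have := sum_energy2 nx; rewrite (bigID (mem (spectrum A))) /=.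
move/eqP; rewrite addr_eq0 => /eqP.
under eq_bigr => a aS.
  have -> : chi a (- x) = 1.
    by rewrite -conj_chi /chi xperp // rmorph1.
  rewrite mulr1; over.
move=> /(congr1 Num.norm); rewrite normrN ger0_norm; last first.
  by apply: sumr_ge0 => a _; rewrite exprn_ge0 ?energy_ge0.
move=> E.
have le1 : (#|A| ^ 4)%:R <= \sum_(a in spectrum A) energy A a ^+ 2.
  rewrite (bigD1 0) //= energy0 -natrX -expnM lerDl sumr_ge0 // => a _.
  by rewrite exprn_ge0 ?energy_ge0.
have : 2 * #|{: P}|%:R * (#|A| ^ 4)%:R <= #|{: P}|%:R * (#|A| ^ 4)%:R :> algC.
  apply: (le_trans (ler_wpM2l _ le1)); first by rewrite mulr_ge0.
  rewrite E; apply: (le_trans (ler_wpM2l _ (ler_norm_sum _ _ _))).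
    by rewrite mulr_ge0.
  rewrite mulr_sumr.
  apply: (@le_trans _ _ (\sum_(a | a \notin spectrum A) (#|A| ^ 3)%:R * energy A a)).
    apply: ler_sum => a; rewrite inE => aS.
    rewrite normrM normr_chi mulr1 normrX (ger0_norm (energy_ge0 _ _)) expr2 mulrA.
    rewrite ler_wpM2r ?energy_ge0 // ltW // real_ltNge //.
      by rewrite ger0_real // mulr_ge0 ?energy_ge0 // mulr_ge0.
  rewrite -mulr_sumr.
  apply: (@le_trans _ _ ((#|A| ^ 3)%:R * \sum_a energy A a)).
    rewrite ler_wpM2l // [leRHS](bigID (mem (spectrum A))) /= lerDr.
    by rewrite sumr_ge0 // => a _; rewrite energy_ge0.
  by rewrite sum_energy -!natrM ler_nat mulnCA -expnSr.
rewrite -!natrM ler_nat mul2n leq_pmul2r ?expn_gt0 ?A0 //.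
by rewrite -addnn -[leqRHS]addn0 leq_add2l leqNgt P0.
Qed.

End Bogolyubov.

Section BoundedGeneration.
Variables (q n : nat).
Local Notation P := 'rV['I_q.+2]_n.

(** The annihilator of the spectrum of A is the kernel of psi, whose values
    range over a finite set of at most (q + 2)^(2 k^2) elements, a bound
    independent of n. A set S that generates the group connects any two values
    of psi by steps in psi(S), and a shortest chain of steps visits no value
    twice. Being generated by S is phrased with sets D stable under translation
    by S, without asking for S = - S: in a finite group the monoid generated by S
    is a group. *)
Lemma bounded_generation (k : nat) (A S : {set P}) :
  (0 < #|A|)%N -> (#|{: P}| <= k * #|A|)%N ->
  (forall D : {set P}, 0 \in D ->
     (forall d s, d \in D -> s \in S -> d + s \in D) -> D = [set: P]) ->
  forall x, exists b c d e (r : seq P),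
    [/\ [/\ b \in A, c \in A, d \in A & e \in A],
        (size r <= q.+2 ^ (2 * k ^ 2))%N, {subset r <= S}
      & x = b - c + (d - e) + \sum_(s <- r) s].
Proof.
move=> A0 kA genS x.
have [z zP] := C_prim_root_exists (isT : (0 < q.+2)%N).
pose psi (y : P) := [ffun i : 'I_#|spectrum z A| => dotv (enum_val i) y].
have psiD y y' i : psi (y + y') i = psi y i + psi y' i.
  by rewrite !ffunE dotvDr.
pose E := [rel v w : {ffun 'I_#|spectrum z A| -> 'I_q.+2} |
  [exists s in S, w == [ffun i => v i + psi s i]]].
have walk p y : path E (psi y) p -> exists r : seq P,
    [/\ size r = size p, {subset r <= S} & psi (y + \sum_(s <- r) s) = last (psi y) p].
  elim: p y => [|v p IHp] y /=; first by exists [::]; rewrite big_nil addr0.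
  case/andP => /existsP[s /andP[sS /eqP ->]].
  have -> : [ffun i => psi y i + psi s i] = psi (y + s).
    by apply/ffunP => i; rewrite psiD ffunE.
  case/IHp => r [szr rS rE]; exists (s :: r); split.
  - by rewrite /= szr.
  - by move=> t; rewrite inE => /orP[/eqP->//|/rS].
  - by rewrite big_cons addrA.
have : x \in [set y | connect E (psi 0) (psi y)].
  rewrite (genS [set y | connect E (psi 0) (psi y)]) ?inE // => d s.
  rewrite !inE => cd sS.
  apply: (connect_trans cd); apply: connect1; apply/existsP; exists s.
  by rewrite sS /=; apply/eqP/ffunP => i; rewrite psiD [RHS]ffunE.
rewrite inE => /connectP[p0 pth]; case/shortenP: pth => p pth up _ lst {p0}.
have [r [szr rS rE]] := walk _ _ pth.
have hx i : psi (x - \sum_(s <- r) s) i = 0.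
  rewrite -lst add0r in rE.
  by apply: (addIr (psi (\sum_(s <- r) s) i)); rewrite -psiD subrK add0r rE.
have [|b [c [d [e [[bA cA dA eA] hE]]]]] := @spectrum_perp _ _ _ zP A (x - \sum_(s <- r) s) A0.
  move=> a aS; have := hx (enum_rank_in aS a); rewrite ffunE enum_rankK_in //.
exists b, c, d, e, r; split=> //; last by rewrite -hE subrK.
rewrite szr; apply: (@leq_trans #|{: {ffun 'I_#|spectrum z A| -> 'I_q.+2}}|).
  by apply: leq_trans (max_card [in psi 0 :: p]); move/card_uniqP: up => ->.
rewrite card_ffun !card_ord leq_exp2l //.
exact: card_spectrum.
Qed.

End BoundedGeneration.

Local Open Scope classical_set_scope.
Local Open Scope ring_scope.

(** * Neighbourhoods and nets in a topological group *)

Section TopologicalGroup.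
Variable M : topologicalZmodType.
Implicit Types (x y c : M) (U V W T : set M).

Lemma subl_continuous c : continuous (fun x : M => x - c).
Proof.
move=> x; apply: (@continuous_comp _ _ _ (fun x => (x, c)) (fun x : M * M => x.1 - x.2)).
  by apply: cvg_pair; [exact: cvg_id|exact: cvg_cst].
exact: sub_continuous.
Qed.

Lemma mulrn_continuous m : continuous (fun x : M => x *+ m).
Proof.
elim: m => [|m IHm] x; first by rewrite /continuous_at mulr0n; exact: cvg_cst.
rewrite /continuous_at mulrS.
have -> : (fun x : M => x *+ m.+1) = (fun x => x + x *+ m).
  by apply/funext => y; rewrite mulrS.
apply: (@continuous_comp _ _ _ (fun x => (x, x *+ m)) (fun x : M * M => x.1 + x.2)).
  by apply: cvg_pair; [exact: cvg_id|exact: IHm].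
exact: add_continuous.
Qed.

Lemma open_translate c V : open V -> open [set x | V (x - c)].
Proof. by apply: open_comp => x _; exact: subl_continuous. Qed.

Lemma nbhs0_sub U : nbhs 0 U ->
  exists2 V, nbhs 0 V & forall x y, V x -> V y -> U (x - y).
Proof.
move=> U0; have := @sub_continuous M (0, 0) U; rewrite /= subr0 => /(_ U0).
case=> -[V W] [/= V0 W0] VWU; exists (V `&` W); first exact: filterI.
by move=> x y [Vx _] [_ Wy]; exact: (VWU (x, y)).
Qed.

Lemma nbhs0_add U : nbhs 0 U ->
  exists2 V, nbhs 0 V & forall x y, V x -> V y -> U (x + y).
Proof.
move=> U0; have := @add_continuous M (0, 0) U; rewrite /= addr0 => /(_ U0).
case=> -[V W] [/= V0 W0] VWU; exists (V `&` W); first exact: filterI.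
by move=> x y [Vx _] [_ Wy]; exact: (VWU (x, y)).
Qed.

(** The number k of terms is bounded, so that one neighbourhood suffices for all
    the sums. *)
Lemma nbhs0_sum U k : nbhs 0 U ->
  exists2 V, nbhs 0 V & forall r : seq M, (size r <= k)%N ->
    (forall x, x \in r -> V x) -> U (\sum_(x <- r) x).
Proof.
elim: k U => [|k IHk] U U0.
  exists setT; first exact: filterT.
  by case=> // _ _; rewrite big_nil; exact: nbhs_singleton.
have [V V0 VU] := nbhs0_add U0; have [W W0 WV] := IHk _ V0.
exists (W `&` V); first exact: filterI.
case=> [_ _|x r szr rW]; first by rewrite big_nil; exact: nbhs_singleton.
rewrite big_cons; apply: VU; first by have [] := rW x (mem_head _ _).
apply: WV => // y yr.
by have [|//] := rW y; rewrite inE yr orbT.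
Qed.

Lemma compact_net U : compact [set: M] -> nbhs 0 U ->
  exists g : seq M, forall x, exists2 c, c \in g & U (x - c).
Proof.
move=> cM U0; pose pM : ptopologicalType := HB.pack (M : Type) M (isPointed.Build M 0).
have {}cM : @cover_compact pM setT by rewrite -compact_cover.
have [|x _|D _ DM] := cM M setT (fun c => [set x | (interior U) (x - c)]).
- by move=> c _; apply: open_translate; exact: open_interior.
- by exists x => //=; rewrite subrr.
- exists (enum_fset D) => x; have [//|c /= cD Ux] := DM x.
  by exists c => //; exact: interior_subset.
Qed.

(** The form of connectedness that suits two sets swept by translates of a
    neighbourhood, which are obviously open. *)
Lemma connected_open_cover (U V : set M) : connected [set: M] -> open U -> open V ->
  U !=set0 -> U `&` V = set0 -> (forall x, U x \/ V x) -> forall x, U x.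
Proof.
move=> cM oU oV U0 UV UVT x; rewrite (cM U U0) //.
  by exists U => //; rewrite setTI.
exists (~` V); first exact: open_closedC.
rewrite setTI seteqP; split=> y; first by move=> Uy Vy; rewrite -[False]/(set0 y) -UV.
by case: (UVT y).
Qed.

End TopologicalGroup.

(** * Compact connected groups are divisible *)

Section Congruence.
Variables (M : zmodType) (m : nat).
Implicit Types (x y : M).

(** Congruence modulo the multiples of m stands for equality in M / m M, so that
    this topological quotient need not be constructed. *)
Definition congr_mod x y : Prop := exists c, x = y + c *+ m.

Lemma congr_mod_refl x : congr_mod x x.
Proof. by exists 0; rewrite mul0rn addr0. Qed.

Lemma congr_mod_trans x y w : congr_mod x y -> congr_mod y w -> congr_mod x w.
Proof. by move=> [c ->] [d ->]; exists (d + c); rewrite mulrnDl addrA. Qed.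

Lemma congr_modD x y x' y' :
  congr_mod x y -> congr_mod x' y' -> congr_mod (x + x') (y + y').
Proof. by move=> [c ->] [d ->]; exists (c + d); rewrite mulrnDl addrACA. Qed.

Lemma congr_mod_sym x y : congr_mod x y -> congr_mod y x.
Proof. by move=> [c ->]; exists (- c); rewrite mulNrn addrK. Qed.

End Congruence.

Section Combination.
Variables (M : zmodType) (q n : nat) (g : 'I_n -> M).
Local Notation P := 'rV['I_q.+2]_n.
Local Notation "x ≡ y" := (congr_mod q.+2 x y) (at level 70).

(** The coefficients are the representatives of the classes v_i in
    0, ..., q + 1, hence additivity modulo q + 2 only. *)
Definition combination (v : P) : M := \sum_i g i *+ v 0 i.
Local Notation phi := combination.

Lemma combinationD v w : phi (v + w) ≡ phi v + phi w.
Proof.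
apply: congr_mod_sym; exists (\sum_i g i *+ ((v 0%R i + w 0%R i) %/ q.+2)%N).
rewrite -sumrMnl /phi -!big_split /=; apply: eq_bigr => i _; rewrite mxE.
rewrite -mulrnA -!mulrnDr; congr (_ *+ _); rewrite [RHS]addnC; exact: divn_eq.
Qed.

Lemma combination0 : phi 0 = 0.
Proof. by rewrite /phi big1 // => i _; rewrite mxE mulr0n. Qed.

Lemma combinationN v : phi (- v) ≡ - phi v.
Proof.
have := congr_mod_sym (combinationD (- v) v); rewrite addNr combination0.
by move=> /congr_modD/(_ (congr_mod_refl _ (- phi v))); rewrite addrK add0r.
Qed.

Lemma combinationB v w : phi (v - w) ≡ phi v - phi w.
Proof.
apply: congr_mod_trans (combinationD _ _) _.
by apply: congr_modD; [exact: congr_mod_refl|exact: combinationN].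
Qed.

Lemma combination_delta i : phi (delta_mx 0 i) = g i.
Proof.
rewrite /phi (bigD1 i) //= mxE !eqxx /= mulr1n big1 ?addr0 // => j ji.
by rewrite mxE (negPf ji) mulr0n.
Qed.

Lemma combination_sum (W : set M) (r : seq P) :
  (forall s, s \in r -> exists2 u, W u & phi s ≡ u) ->
  exists u : seq M, [/\ size u = size r, (forall x, x \in u -> W x)
    & phi (\sum_(s <- r) s) ≡ \sum_(x <- u) x].
Proof.
elim: r => [|s r IHr] rW.
  by exists [::]; rewrite !big_nil combination0; split=> //; exact: congr_mod_refl.
have [|u [szu uW ur]] := IHr; first by move=> t tr; apply: rW; rewrite inE tr orbT.
have [x Wx sx] := rW s (mem_head _ _); exists (x :: u); split.
- by rewrite /= szu.
- by move=> y; rewrite inE => /orP[/eqP->|/uW].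
- rewrite !big_cons; apply: congr_mod_trans (combinationD _ _) _.
  exact: congr_modD.
Qed.
End Combination.

Lemma pigeonhole (T : finType) k (f : T -> 'I_k) : (0 < #|T|)%N ->
  exists i, (#|T| <= k * #|[set x | f x == i]%SET|)%N.
Proof.
case/card_gt0P => t _; have i0 := f t.
have [i _ iM] := @arg_maxnP _ i0 xpredT (fun i => #|[set x | f x == i]%SET|) isT.
exists i; rewrite -[X in (X <= _)%N]sum1_card (partition_big f xpredT) //=.
apply: leq_trans (_ : \sum_(j < k) #|[set x | f x == i]%SET| <= _)%N; last first.
  by rewrite sum_nat_const card_ord.
by apply: leq_sum => j _; apply: leq_trans (iM j isT); rewrite sum1dep_card.
Qed.

Section Divisibility.
Variable M : topologicalZmodType.
Hypotheses (cM : compact [set: M]) (kM : connected [set: M]).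
Local Notation "x ≡ y %[ m ]" := (congr_mod m x y) (at level 70).

(** The point of the proof is the order of the choices: k depends on T alone,
    the length of the sums in [bounded_generation] on k alone, then W is chosen
    small with respect to this length, and only then the net g, whose size n
    is out of control. *)
Lemma dense_multiples q (T : set M) x : nbhs 0 T -> exists2 t, T t & x ≡ t %[q.+2].
Proof.
move=> T0.
have [T1 T10 T1T] := nbhs0_add T0.
have [T2 T20 T2T1] := nbhs0_add T10.
have [T3 T30 T3T2] := nbhs0_add T20.
have [U U0 UT3] := nbhs0_sub T30.
have [xs xsP] := compact_net cM U0.
pose k := size xs.
have [V V0 VT] := nbhs0_sum (q.+2 ^ (2 * k ^ 2)) T20.
have [W' W'0 W'V] := nbhs0_sub V0.
pose W := (W' `&` T1)°.
have W0 : nbhs 0 W by apply: nbhs_interior; exact: filterI.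
have WW' w : W w -> W' w by move=> /interior_subset[].
have WT1 w : W w -> T1 w by move=> /interior_subset[].
have oW : open W by exact: open_interior.
have [g gP] := compact_net cM W0.
pose n := size g; pose phi := @combination M q n (fun i => nth 0 g i).
have gP' y : exists i, W (y - phi (delta_mx 0 i)).
  have [c cg Wyc] := gP y; have ltc : (index c g < n)%N by rewrite index_mem.
  by exists (Ordinal ltc); rewrite /phi combination_delta /= nth_index.
have [A [A0 kA AU]] : exists A : {set 'rV['I_q.+2]_n},
    [/\ (0 < #|A|)%N, (#|{: 'rV['I_q.+2]_n}| <= k * #|A|)%N
      & forall a b, a \in A -> b \in A -> T3 (phi a - phi b)].
  have cP v : exists i : 'I_k, U (phi v - nth 0 xs i).
    have [c cxs Uc] := xsP (phi v); have ltc : (index c xs < k)%N by rewrite index_mem.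
    by exists (Ordinal ltc); rewrite /= nth_index.
  have P0 : (0 < #|{: 'rV['I_q.+2]_n}|)%N by apply/card_gt0P; exists 0.
  have [i kA] := pigeonhole (fun v => sval (cid (cP v))) P0.
  exists [set v | sval (cid (cP v)) == i]%SET; split=> //.
    by move: (leq_trans P0 kA); rewrite muln_gt0 => /andP[].
  move=> a b; rewrite !inE => /eqP ia /eqP ib.
  have /= Ua := svalP (cid (cP a)); have /= Ub := svalP (cid (cP b)).
  rewrite ia in Ua; rewrite ib in Ub.
  by rewrite -(subrKA (nth 0 xs i)) -[_ - phi b]opprB; exact: UT3.
(* Differences of two points of W lie in V: W controls both the distance to the
   net and the steps of the walks. *)
pose S : {set 'rV['I_q.+2]_n} :=
  [set s | `[< exists2 u, V u & phi s ≡ u %[q.+2] >]]%SET.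
(* The points of M near phi D and those near the image of the complement of D
   form two open sets that cover M; they are disjoint since a difference of two
   elements of W is small enough for S. *)
have genS (D : {set 'rV['I_q.+2]_n}) : 0 \in D ->
    (forall d s, d \in D -> s \in S -> d + s \in D) -> D = [set: 'rV['I_q.+2]_n]%SET.
  move=> D0 DS; apply/setP => v; rewrite !inE; apply/negP => /negP vD.
  pose O (E : pred 'rV['I_q.+2]_n) := [set x | exists2 d, E d &
    exists y, W (x - (phi d + y *+ q.+2))].
  have oO E : open (O E).
    have -> : O E = \bigcup_(d in [set d | E d]) \bigcup_y
        [set x | W (x - (phi d + y *+ q.+2))].
      rewrite seteqP; split=> y [d Ed [c]]; first by exists d => //; exists c.
      by exists d => //; exists c.
    by apply: bigcup_open => d _; apply: bigcup_open => y _; exact: open_translate.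
  have OE (E : pred 'rV['I_q.+2]_n) d : E d -> O E (phi d).
    move=> Ed; exists d => //; exists 0.
    by rewrite mul0rn addr0 subrr; exact: nbhs_singleton.
  have O12 : O [in D] `&` O [predC D] = set0.
    rewrite -subset0 => y [[d dD [s Ws]] [f fD [t Wt]]].
    case/negP: fD; rewrite -[f](subrK d) addrC; apply: DS => //.
    rewrite inE; apply/asboolP.
    exists (y - (phi d + s *+ q.+2) - (y - (phi f + t *+ q.+2))).
      by apply: W'V; exact: WW'.
    apply: congr_mod_trans (combinationB _ _ _) _.
    exists (s - t); rewrite mulrnBl -/phi.
    rewrite (opprB y) (addrC (y - _)) subrKA (opprD (phi d)) (addrACA (phi f)).
    by rewrite -[RHS]addrA subrKA subrr addr0.
  suff H : (O [in D] (phi v) -> False).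
    apply: H; apply: connected_open_cover (oO [in D]) (oO [predC D]) _ O12 _ _ => //.
      by exists (phi 0); exact: OE.
    move=> y; have [i Wyi] := gP' y.
    by case: (boolP (delta_mx 0 i \in D)) => iD; [left|right]; exists (delta_mx 0 i) => //;
      exists 0; rewrite mul0rn addr0.
  by move=> Ov; rewrite -[False]/(set0 (phi v)) -O12; split=> //; exact: OE.
(* The net point near x is phi of a basis vector, which is then decomposed. *)
have [i Wxi] := gP' x; set c := phi _ in Wxi.
have [a [b [d [e [r [[aA bA dA eA] szr rS dE]]]]]] :=
  bounded_generation A0 kA genS (delta_mx 0 i).
have [u [szu uV ru]] : exists u : seq M, [/\ size u = size r, (forall x, x \in u -> V x)
    & phi (\sum_(s <- r) s) ≡ \sum_(x <- u) x %[q.+2]].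
  by apply: combination_sum => s /rS; rewrite inE => /asboolP.
exists (phi a - phi b + (phi d - phi e) + \sum_(x <- u) x + (x - c)).
  apply: T1T; last exact: WT1.
  by apply: T2T1; [apply: T3T2; exact: AU|apply: VT => //; rewrite szu].
rewrite -{1}[x](subrK c) addrC; apply: congr_modD; last exact: congr_mod_refl.
rewrite /c dE; apply: congr_mod_trans (combinationD _ _ _) _; apply: congr_modD => //.
apply: congr_mod_trans (combinationD _ _ _) _.
by apply: congr_modD; exact: combinationB.
Qed.
End Divisibility.

Definition continuously_divisible (G : topologicalZmodType) : Prop :=
  forall m, (0 < m)%N -> exists d : G -> G,
    [/\ continuous d, cancel (fun x => x *+ m) d & cancel d (fun x => x *+ m)].

Section CompactConnected.
Variable M : topologicalZmodType.
Hypotheses (hM : hausdorff_space M) (cM : compact [set: M]).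

Lemma compact_image_closed (m : nat) (C : set M) :
  closed C -> closed ((fun x => x *+ m) @` C).
Proof.
move=> clC; apply: compact_closed => //; apply: continuous_compact.
  by apply: continuous_subspaceT; exact: mulrn_continuous.
exact: subclosed_compact clC cM _.
Qed.

(** The multiples of a given integer form a compact, hence closed, subgroup,
    which is dense. *)
Lemma compact_connected_divisible : connected [set: M] -> divisible M.
Proof.
move=> kM x [//|[_|q _]]; first by exists x; rewrite mulr1n.
apply: contrapT => nx.
have cl := @compact_image_closed q.+2 setT (@closedT _).
have : nbhs 0 [set t | (~` ((fun y : M => y *+ q.+2) @` setT)) (t - x)].
  apply: open_nbhs_nbhs; split; first by apply: open_translate; exact: closed_openC.
  rewrite /= sub0r => -[y _ yx]; apply: nx; exists (- y).
  by rewrite mulNrn yx opprK.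
move=> /(dense_multiples cM kM q x)[t /= tn [c xt]]; apply: tn; exists (- c) => //.
by rewrite mulNrn xt (opprD t) (addrA t) subrr add0r.
Qed.

(** A continuous bijection between compact Hausdorff spaces is a
    homeomorphism. *)
Lemma continuously_divisible_compact : torsion_free M -> divisible M ->
  continuously_divisible M.
Proof.
move=> tM dM m m0.
have [d dK] := choice (fun x => dM x m m0).
have Kd : cancel (fun x : M => x *+ m) d.
  move=> x; apply/eqP; rewrite -subr_eq0; apply/eqP; apply: (tM _ _ m0).
  by rewrite mulrnBl dK subrr.
exists d; split=> //; apply/continuous_closedP => C clC.
suff -> : d @^-1` C = (fun x => x *+ m) @` C by exact: compact_image_closed.
rewrite seteqP; split=> x /=; first by move=> Cdx; exists (d x).
by move=> [y Cy <-]; rewrite Kd.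
Qed.
End CompactConnected.

(** * Groups on which multiplication by integers is a homeomorphism *)

Lemma continuously_divisible_discrete (A : topologicalZmodType) :
  discrete A -> torsion_free A -> divisible A -> continuously_divisible A.
Proof.
move=> dA tA vA m m0; have [d dK] := choice (fun x => vA x m m0).
exists d; split=> // [|x]; first by apply/continuousP => U _; exact: dA.
apply/eqP; rewrite -subr_eq0; apply/eqP; apply: (tA _ _ m0).
by rewrite mulrnBl dK subrr.
Qed.

Lemma continuously_divisible_row (R : realType) n : continuously_divisible 'rV[R]_n.
Proof.
move=> m m0; have nz : m%:R != 0 :> R by rewrite pnatr_eq0 -lt0n.
exists (fun x => m%:R^-1 *: x); split=> [|x|x].
- exact: scaler_continuous.
- by rewrite -[x *+ m]scaler_nat scalerA mulVf // scale1r.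
- by rewrite -scaler_nat scalerA mulfV // scale1r.
Qed.

Lemma continuously_divisible_dsum (G H : topologicalZmodType) :
  continuously_divisible G -> continuously_divisible H -> continuously_divisible (dsum G H).
Proof.
move=> dG dH m m0; have [d [dc Kd dK]] := dG m m0; have [e [ec Ke eK]] := dH m m0.
have E (x : dsum G H) k : x *+ k = (x.1 *+ k, x.2 *+ k).
  elim: k => [//|k IHk]; by rewrite !mulrS IHk.
exists (fun x : dsum G H => (d x.1, e x.2) : dsum G H); split=> [x|x|x].
- apply: (@cvg_pair _ _ _ (nbhs x) (nbhs (d x.1)) (nbhs (e x.2))).
    by apply: (@continuous_comp _ _ _ fst d); [exact: cvg_fst|exact: dc].
  by apply: (@continuous_comp _ _ _ snd e); [exact: cvg_snd|exact: ec].
- by rewrite E /= Kd Ke; case: x.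
- by rewrite E /= dK eK; case: x.
Qed.

Lemma continuously_divisible_prod (I : Type) (K : I -> topologicalZmodType) :
  (forall i, continuously_divisible (K i)) -> continuously_divisible (prod_topology K).
Proof.
move=> dK m m0.
have E (x : prod_topology K) k : x *+ k = fun i => x i *+ k.
  elim: k => [//|k IHk]; rewrite mulrS IHk.
  by apply: functional_extensionality_dep => i; rewrite mulrS.
pose d i := sval (cid (dK i m m0)); have dP i := svalP (cid (dK i m m0)).
exists (fun x : prod_topology K => (fun i => d i (x i)) : prod_topology K); split.
- apply: continuous_prod_topology => i x.
  apply: (@continuous_comp _ _ _ (fun x : prod_topology K => x i) (d i)).
    exact: Defs.eval_continuous.
  by have [dc _ _] := dP i; exact: dc.
- move=> x; rewrite E; apply: functional_extensionality_dep => i.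
  by have [_ Kd _] := dP i; exact: Kd.
- move=> x; rewrite E; apply: functional_extensionality_dep => i.
  by have [_ _ dK'] := dP i; exact: dK'.
Qed.

Lemma continuously_divisible_iso (G H : topologicalZmodType) :
  topologically_isomorphic G H -> continuously_divisible H -> continuously_divisible G.
Proof.
move=> [f [g [fK gK fc gc]]] dH m m0; have [d [dc Kd dK]] := dH m m0.
exists (fun x => g (d (f x))); split=> [x|x|x].
- apply: (@continuous_comp _ _ _ (fun x => d (f x)) g); last exact: gc.
  by apply: (@continuous_comp _ _ _ f d); [exact: fc|exact: dc].
- by rewrite raddfMn Kd fK.
- by rewrite -raddfMn dK fK.
Qed.

(** * Division in the p-adic numbers *)

Section PadicDivision.
Variables (p m : nat).
Hypotheses (pp : prime p) (m0 : (0 < m)%N).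
Implicit Types (x y : padic p) (a r : rat).
Local Notation e := (logn p m).

Let mQ0 : m%:R != 0 :> rat.
Proof. by rewrite pnatr_eq0 -lt0n. Qed.

(** Here m = p^e k with k prime to p: multiplication by k preserves the balls,
    multiplication by p^e shifts them by e. *)
Lemma pball_divn n a : pball p (n + e) a <-> pball p n (a / m%:R).
Proof.
have [k pk mE] := pfactor_coprime pp m0.
have k0 : (0 < k)%N by move: m0; rewrite mE muln_gt0 => /andP[].
have kQ0 : k%:R != 0 :> rat by rewrite pnatr_eq0 -lt0n.
have pQ0 : p%:R != 0 :> rat by rewrite pnatr_eq0 -lt0n prime_gt0.
have peQ0 : p%:R ^+ e != 0 :> rat by rewrite expf_neq0.
have mQ : m%:R = k%:R * p%:R ^+ e :> rat by rewrite {1}mE natrM natrX.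
split=> [[r rZ <-]|[r rZ rE]].
  exists (r / k%:R).
    apply: (@Zlocal_frac p (numq r) (`|denq r| * k)%N).
    - by rewrite muln_eq0 absz_eq0 denq_eq0 -lt0n k0.
    - by rewrite coprimeMr rZ.
    - rewrite natrM natr_absz normr_denq numqE; field => //.
  by rewrite mQ exprD; field; rewrite kQ0 peQ0.
exists (r * k%:R).
  apply: (@Zlocal_frac p (numq r * k%:Z) `|denq r|%N) => //.
  - by rewrite absz_eq0 denq_eq0.
  - by rewrite natr_absz normr_denq intrM numqE -pmulrn; ring.
rewrite -[a](divfK mQ0) -rE mQ exprD; ring.
Qed.

(** Residues of the same level are cosets of the same subgroup, so that they
    coincide as soon as they meet. *)
Lemma padic_eq x y : (forall n, exists2 a, x n a & y n a) -> x = y.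
Proof.
move=> xy; apply: padic_inj => n; have [a xa ya] := xy n.
rewrite seteqP; split=> r xr; [apply/(padicP ya)|apply/(padicP xa)].
  exact/(padicP xa).
exact/(padicP ya).
Qed.

Lemma padic_mulrn x n a k : x n a -> (x *+ k) n (a *+ k).
Proof.
move=> xa; elim: k => [|k IHk]; first exact: pball0.
by rewrite !mulrS; exists a => //; exists (a *+ k).
Qed.

Let div_res (s : set rat) : set rat := [set a / m%:R | a in s].

Let div_resP x n : exists a, div_res (x (n + e)%N) = [set a + r | r in pball p n].
Proof.
have [a xa] := padic_ex x (n + e); exists (a / m%:R).
rewrite seteqP; split=> [_ [b xb <-]|_ [r rB <-]].
  exists (b / m%:R - a / m%:R); last by ring.
  by rewrite -mulrBl; apply/pball_divn; exact/(padicP xa).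
exists (a + r * m%:R); last by field.
by apply/(padicP xa)/pball_divn; rewrite addrC addKr mulfK.
Qed.

Let div_resS x n : div_res (x (n.+1 + e)%N) `<=` div_res (x (n + e)%N).
Proof. by move=> _ [a xa <-]; exists a => //; exact: padic_resS. Qed.

(** The residue of x / m modulo p^n is read on the residue of x modulo
    p^(n + e). *)
Definition padic_divn x : padic p := Padic (div_resP x) (@div_resS x).

(** Each residue of the quotient is a function of a single residue of x, that
    is of an element of a discrete space. *)
Lemma padic_divn_continuous : continuous padic_divn.
Proof.
apply: continuous_comp_initial; apply: continuous_prod_topology => n x.
apply: (@continuous_comp _ (discrete_topology (set rat)) (discrete_topology (set rat))
  (fun x => padic_seq x (n + e)%N) div_res).
  apply: (@continuous_comp _ _ _ (@padic_seq p) (fun f => f (n + e)%N)).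
    exact: initial_continuous.
  exact: Defs.eval_continuous.
by move: (padic_seq x _); apply/continuousP => U _; exact: discrete_open.
Qed.

Lemma padic_res_le x n k : (n <= k)%N -> x k `<=` x n.
Proof.
move=> /subnK <-; elim: (k - n)%N => [//|l IHl].
by rewrite addSn => a /padic_resS/IHl.
Qed.

Lemma padic_divnK :
  cancel (fun x => x *+ m) padic_divn /\ cancel padic_divn (fun x => x *+ m).
Proof.
split=> x; apply: padic_eq => n; have [a xa] := padic_ex x (n + e);
  exists a; try exact: padic_res_le (leq_addr _ _) _ xa.
  by exists (a *+ m); [exact: padic_mulrn|rewrite -(mulr_natr a) mulfK].
have aE : a = (a / m%:R) *+ m by rewrite -(mulr_natr (a / _)) divfK.
by rewrite [X in padic_res _ _ X]aE; apply: padic_mulrn; exists a.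
Qed.
End PadicDivision.

Lemma continuously_divisible_padic p : prime p -> continuously_divisible (padic p).
Proof.
move=> pp m m0; exists (@padic_divn p m pp m0).
have [] := @padic_divnK p m pp m0.
by split=> //; exact: padic_divn_continuous.
Qed.

(** * Compact torsion groups have bounded exponent *)

(** Baire's argument: if no C n were a neighbourhood of 0, none would contain a
    nonempty open set, as C n is a subgroup; then nonempty open sets V n could
    be chosen with the closure of V n.+1 contained in V n and disjoint from C n,
    and a common point of their closures would not be torsion. *)
Lemma compact_torsion_bounded (X : topologicalZmodType) :
  hausdorff_space X -> compact [set: X] -> torsion X ->
  exists2 m, (0 < m)%N & forall x : X, x *+ m = 0.
Proof.
move=> hX cX tX.
pose C n := [set x : X | x *+ n`! = 0].
have clC n : closed (C n).
  have -> : C n = (fun x : X => x *+ n`!) @^-1` [set 0] by [].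
  apply: preimage_closed => [x _|]; first exact: mulrn_continuous.
  exact: accessible_closed_set1 (hausdorff_accessible hX) 0.
have [[n Cn0]|nC] := pselect (exists n, nbhs 0 (C n)).
  have [g gP] := compact_net cX Cn0.
  have tX' (x : X) : exists k, (0 < k)%N /\ x *+ k = 0 by have [k] := tX x; exists k.
  have [e eP] := choice tX'.
  exists (n`! * \prod_(c <- g) e c)%N.
    by rewrite muln_gt0 fact_gt0 prodn_gt0 // => c; have [] := eP c.
  move=> x; have [c cg Cxc] := gP x.
  rewrite -[x](subrK c) mulrnDl mulrnA Cxc mul0rn add0r mulnC (big_rem c cg) /=.
  by rewrite -mulnA mulrnA (eP c).2 mul0rn.
pose op := {V : set X | open V /\ V !=set0}.
have step n (V : op) : exists V' : op, closure (sval V') `<=` sval V `\` C n.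
  case: V => V [oV [v Vv]] /=.
  have [x Vx nx] : exists2 x, V x & ~ C n x.
    apply: contrapT => VC; apply: nC; exists n.
    have : nbhs 0 [set t | V (t - (- v))].
      by apply: open_nbhs_nbhs; split; [exact: open_translate|rewrite /= opprK add0r].
    apply: filterS => t; rewrite /= opprK => Vtv.
    have VC' y : V y -> C n y.
      by move=> Vy; apply: contrapT => ny; apply: VC; exists y.
    by rewrite /C /= -[t](addrK v) mulrnBl (VC' _ Vtv) (VC' _ Vv) subrr.
  have : nbhs x (V `\` C n).
    by apply: open_nbhs_nbhs; split=> //; rewrite setDE;
      apply: openI => //; exact: closed_openC.
  move=> /(compact_regular hX cX filterT)[U Ux UV].
  have oU : open U° /\ U° !=set0.
    by split; [exact: open_interior|exists x].
  exists (exist _ (interior U) oU : op) => /=; apply: subset_trans UV; apply: closureS.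
  exact: interior_subset.
have [s sP] := choice (fun nV => step nV.1 nV.2); rewrite /= in sP.
have oT : open [set: X] /\ [set: X] !=set0 by split; [exact: openT|exists 0].
pose V := fix V n : op := if n is k.+1 then s (k, V k) else exist _ _ oT.
have VS n : closure (sval (V n.+1)) `<=` sval (V n) `\` C n by exact: sP.
have Vle n k : (n <= k)%N -> sval (V k) `<=` sval (V n).
  move=> /subnK <-; elim: (k - n)%N => [//|l IHl].
  by rewrite addSn => x /subset_closure/VS[/IHl].
pose F := filter_from setT (fun n => sval (V n)).
have FF : ProperFilter F.
  apply: filter_from_proper; last by move=> n _; have [] := svalP (V n).
  apply: filter_from_filter; first by exists 0%N.
  move=> n k _ _; exists (maxn n k) => // x Vx.
  by split; apply: Vle Vx; rewrite ?leq_maxl ?leq_maxr.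
have [p [_ clp]] := cX F FF filterT.
have [k k0 pk] := tX p.
have : closure (sval (V k.+1)) p by move=> B pB; apply: clp => //; exists k.+1.
move=> /VS[_ nCp]; exfalso; apply: nCp.
have [l kl] : exists l, k`! = (k * l)%N.
  by exists (k`! %/ k)%N; rewrite mulnC divnK // dvdn_fact // k0 leqnn.
by rewrite /C /= kl mulrnA pk mul0rn.
Qed.

(** * Splitting of extensions *)

(** With l b the element of G whose image is m b, the retraction is
    r b = l b / m. Its continuity uses that i is a homeomorphism onto its image.
    The section of q sends the class of b to t b = b - i (r b), which is a
    function of q b because r is a retraction; it is continuous since q is open. *)
Lemma Ext_zero_continuously_divisible (X G : lcaGroup) m :
  continuously_divisible G -> (0 < m)%N -> (forall x : X, x *+ m = 0) -> Ext_zero X G.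
Proof.
move=> dG m0 mX; have [d [dc Kd dK]] := dG m m0.
case=> B i q [ic io] [qc qo] iI ex sur.
have qi a : q (i a) = 0.
  by have : range i (i a); [exists a|rewrite ex].
have h b : exists a, i a = b *+ m.
  have : [set b | q b = 0] (b *+ m) by rewrite /= raddfMn mX.
  by rewrite -ex => -[a _ ai]; exists a.
have [l lP] := choice h.
have lD : {morph l : a b / a - b}.
  by move=> a b; apply: iI; rewrite raddfB !lP mulrnBl.
have dB : {morph d : a b / a - b}.
  by move=> a b; rewrite -{1}[a]dK -{1}[b]dK -mulrnBl Kd.
have rB : {morph (fun b => d (l b)) : a b / a - b} by move=> a b; rewrite lD dB.
pose r : {additive B -> G} :=
  HB.pack (fun b => d (l b)) (GRing.isZmodMorphism.Build _ _ _ rB).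
have ri a : r (i a) = a.
  by rewrite /= (_ : l _ = a *+ m) ?Kd //; apply: iI; rewrite lP raddfMn.
have rc : continuous r.
  apply/continuousP => U oU.
  have oV : open (d @^-1` U) by move/continuousP: dc; exact.
  have [V oV' iV] := io _ oV.
  have -> : r @^-1` U = (fun b => b *+ m) @^-1` V.
    rewrite seteqP; split=> b /=.
      move=> Ub; have : (i @` (d @^-1` U)) (b *+ m) by exists (l b); rewrite ?lP.
      by rewrite iV => -[].
    move=> Vb; have : (V `&` range i) (b *+ m).
      by split=> //; exists (l b); rewrite ?lP.
    by rewrite -iV => -[a Ua ab]; rewrite /= (_ : l b = a) //; apply: iI; rewrite lP.
  by apply: open_comp => // b _; exact: mulrn_continuous.
clearbody r.
have h' x : exists b, q b = x.
  by have : range q x; [rewrite sur|move=> [b _ bx]; exists b].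
have [s sq] := choice h'.
pose t b := b - i (r b).
have tq b b' : q b = q b' -> t b = t b'.
  move=> qb; have : range i (b - b') by rewrite ex /= raddfB qb subrr.
  move=> [a _ ab]; rewrite -[b](subrK b') -ab /t raddfD ri raddfD opprD addrACA.
  by rewrite subrr add0r.
pose f b : dsum G X := (r b, q b).
pose g (y : dsum G X) := i y.1 + t (s y.2).
have fB : {morph f : a b / a - b}.
  by move=> a b; rewrite /f !raddfB.
have gf : cancel f g.
  by move=> b; rewrite /g /f /= (tq _ b) ?sq // /t addrC subrK.
have qt b : q (t b) = q b by rewrite /t raddfB qi subr0.
have rt b : r (t b) = 0 by rewrite /t raddfB ri subrr.
have fg : cancel g f.
  by move=> [a x]; rewrite /f /g /= raddfD ri rt raddfD qi qt sq addr0 add0r.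
have gB : {morph g : a b / a - b}.
  by move=> a b; apply: (can_inj gf); rewrite fB !fg.
have fc : continuous f.
  move=> b; apply: (@cvg_pair _ _ _ (nbhs b) (nbhs (r b)) (nbhs (q b))).
    exact: rc.
  exact: qc.
have gc : continuous g.
  have tc : continuous t.
    move=> b; apply: (@continuous_comp _ _ _ (fun b => (b, i (r b)))
      (fun y : B * B => y.1 - y.2)); last exact: sub_continuous.
    apply: cvg_pair; first exact: cvg_id.
    by apply: (@continuous_comp _ _ _ r i); [exact: rc|exact: ic].
  have tsc : continuous (fun x => t (s x)).
    apply/continuousP => U oU.
    have oV : open (t @^-1` U) by move/continuousP: tc; exact.
    have [V oV' qV] := qo _ oV.
    suff -> : (fun x => t (s x)) @^-1` U = V by [].
    rewrite -[V]setIT -sur -qV seteqP; split=> x /=.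
      by move=> Ux; exists (s x); rewrite ?sq.
    by move=> [b Ub <-]; rewrite (tq _ b) ?sq.
  move=> y; apply: (@continuous_comp _ _ _ (fun y : G * X => (i y.1, t (s y.2)))
    (fun y : B * B => y.1 + y.2)); last exact: add_continuous.
  apply: cvg_pair.
    by apply: (@continuous_comp _ _ _ fst i); [exact: cvg_fst|exact: ic].
  by apply: (@continuous_comp _ _ _ snd (fun x => t (s x))); [exact: cvg_snd|exact: tsc].
pose fA : {additive B -> dsum G X} := HB.pack f (GRing.isZmodMorphism.Build _ _ f fB).
pose gA : {additive dsum G X -> B} := HB.pack g (GRing.isZmodMorphism.Build _ _ g gB).
exists fA; split=> //.
  by exists gA; split.
by move=> a; rewrite /= /f ri qi.
Qed.

Unset Implicit Arguments.

Theorem theorem1p6 (R : realType) (X G A M : lcaGroup) (n : nat)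
  (I : {fset nat}) :
  compact [set: X] -> torsion X ->
  discrete A -> torsion_free A -> divisible A ->
  compact [set: M] -> connected [set: M] -> torsion_free M ->
  (forall p : nat, p \in I -> prime p) ->
  topologically_isomorphic G
    (dsum 'rV[R]_n (dsum A (dsum M (prod_topology (fun p : I => padic (val p)))))) ->
  Ext_zero X G.
Proof.
move=> cX tX dA tA vA cM kM tM Ip GE.
have [m m0 mX] := compact_torsion_bounded (@lca_hausdorff X) cX tX.
apply: Ext_zero_continuously_divisible m0 mX; apply: continuously_divisible_iso GE _.
apply: continuously_divisible_dsum; first exact: continuously_divisible_row.
apply: continuously_divisible_dsum; first exact: continuously_divisible_discrete.
apply: continuously_divisible_dsum.
  apply: continuously_divisible_compact => //; first exact: lca_hausdorff.
  exact: (compact_connected_divisible (@lca_hausdorff M)).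
apply: continuously_divisible_prod => p; apply: continuously_divisible_padic.
by apply: Ip; exact: valP.
Qed.
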